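(* Let $n\in\mathbb{N}$, let $K$ be a singular, strictly concave and strictly monotone kernel function and let $J:[0,1]\to\mathbb{R}\cup\{-\infty\}$ be an upper semicontinuous $n$-field function. Let $r_1,\dots,r_n>0$ and consider the sum of translates function $F(\mathbf{y},t)=J(t)+\sum_{j=1}^n r_jK(t-y_j)$. Then there is a minimum point $\mathbf{w}\in\overline{S}$ of $\overline{m}$ on $\overline{S}$ (a minimax point), i.e., \[ M(\overline{S}):=\inf_{\mathbf{x}\in\overline{S}}\overline{m}(\mathbf{x})=\inf_{\mathbf{x}\in\overline{S}}\max_{j=0,1,\ldots,n}m_j(\mathbf{x})=\overline{m}(\mathbf{w})=\max_{j=0,1,\ldots,n}m_j(\mathbf{w}). \] Each such minimum point $\mathbf{w}\in\overline{S}$ is an equioscillation point, i.e., it satisfies \[ m_0(\mathbf{w})=m_1(\mathbf{w})=\ldots=m_n(\mathbf{w}). \] Furthermore, the point $\mathbf{w}$ is non-singular, i.e., it belongs to the regularity set $Y$, so in particular to the open simplex $S$.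
   Context: A kernel function is a function $K:(-1,0)\cup(0,1)\to\mathbb{R}$ that is concave on $(-1,0)$ and concave on $(0,1)$ and satisfies $\lim_{t\downarrow0}K(t)=\lim_{t\uparrow0}K(t)$. It is extended to $[-1,1]$, with values in $\mathbb{R}\cup\{-\infty\}$, by $K(0):=\lim_{t\to0}K(t)$, $K(-1):=\lim_{t\downarrow-1}K(t)$, $K(1):=\lim_{t\uparrow1}K(t)$. $K$ is singular if $K(0)=-\infty$; strictly concave if it is strictly concave on each of $(-1,0)$ and $(0,1)$; strictly monotone if it is strictly decreasing on $[-1,0)$ and strictly increasing on $(0,1]$. An $n$-field function is a function $J:[0,1]\to\mathbb{R}\cup\{-\infty\}$ that is bounded above and takes finite values at more than $n$ different points, where the points $0$ and $1$ are counted with weight $1/2$ and points of $(0,1)$ with weight $1$. Let $S:=\{\mathbf{y}=(y_1,\dots,y_n)\in(0,1)^n: 0<y_1<\cdots<y_n<1\}$ (open simplex) and $\overline{S}:=\{\mathbf{y}\in[0,1]^n:0\le y_1\le\cdots\le y_n\le1\}$. The function $F$ is defined for $\mathbf{y}\in\overline{S}$, $t\in[0,1]$. With $y_0:=0$, $y_{n+1}:=1$ put $I_j(\mathbf{y}):=[y_j,y_{j+1}]$ and $m_j(\mathbf{y}):=\sup_{t\in I_j(\mathbf{y})}F(\mathbf{y},t)$ for $j=0,1,\dots,n$, and $\overline{m}(\mathbf{y}):=\max_{j=0,\dots,n}m_j(\mathbf{y})$. The regularity set is $Y:=\{\mathbf{y}\in S: m_j(\mathbf{y})\ne-\infty\text{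 for }j=0,1,\dots,n\}$. *)

(* Defs.v *)
From HB Require Import structures.
From mathcomp Require Import all_boot all_order all_algebra.
From mathcomp Require Import all_classical all_reals all_analysis.

Set Implicit Arguments.
Unset Strict Implicit.
Unset Printing Implicit Defensive.

Import Order.TTheory GRing.Theory Num.Theory.
Import numFieldNormedType.Exports.

Local Open Scope classical_set_scope.
Local Open Scope ring_scope.

Definition concave_on {R : realType} (A : set R) (f : R -> R) : Prop :=
  convex_function (A : set R^o) (fun t : R^o => - f t : R^o).

Definition strictly_concave_on {R : realType} (A : set R) (f : R -> R) : Prop :=
  forall x y p : R, A x -> A y -> x != y -> 0 < p < 1 ->
    p * f x + (1 - p) * f y < f (p * x + (1 - p) * y).

(* Points outside A are isolated in [subspace A], so this only constrains the
   restriction of f to A. *)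
Definition upper_semicontinuous_on {R : realType} (A : set R)
    (f : R -> \bar R) : Prop :=
  lower_semicontinuous ((fun t => - f t)%E : subspace A -> \bar R).

(* A function on (-1,0) `|` (0,1) is represented by a total function K : R -> R
   whose other values are never used. *)
Definition kernel_function {R : realType} (K : R -> R) : Prop :=
  [/\ concave_on `]-1, 0[ K,
      concave_on `]0, 1[ K &
      exists l : \bar R,
        (K t)%:E @[t --> 0^'+] --> l /\ (K t)%:E @[t --> 0^'-] --> l].

(* The extension of K to [-1, 1]; values outside [-1, 1] are irrelevant. *)
Definition kext {R : realType} (K : R -> R) (t : R) : \bar R :=
  if t == 0 then lim ((K s)%:E @[s --> (0 : R)^'])
  else if t == -1 then lim ((K s)%:E @[s --> (-1 : R)^'+])
  else if t == 1 then lim ((K s)%:E @[s --> (1 : R)^'-])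
  else (K t)%:E.

Definition singular {R : realType} (K : R -> R) : Prop := kext K 0 = -oo%E.

Definition strictly_concave {R : realType} (K : R -> R) : Prop :=
  strictly_concave_on `]-1, 0[ K /\ strictly_concave_on `]0, 1[ K.

Definition strictly_monotone {R : realType} (K : R -> R) : Prop :=
  (forall s t : R, -1 <= s -> s < t -> t < 0 -> (kext K t < kext K s)%E) /\
  (forall s t : R, 0 < s -> s < t -> t <= 1 -> (kext K s < kext K t)%E).

(* Only the values of J on [0, 1] matter.  The real upper bound excludes the
   value +oo there.  The second condition says that the total weight of the
   points of finiteness (a possibly infinite set) exceeds n, witnessed by a
   finite list s of distinct such points. *)
Definition field_function {R : realType} (n : nat) (J : R -> \bar R) : Prop :=
  (exists M : R, forall t : R, 0 <= t <= 1 -> (J t <= M%:E)%E) /\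
  (exists s : seq R,
     [/\ uniq s,
         forall t : R, t \in s -> 0 <= t <= 1 /\ J t \is a fin_num &
         n%:R < \sum_(t <- s)
                  (if (t == 0) || (t == 1) then 2^-1 else 1 : R)]).

(* The extended nodes y_k: y_0 = 0, y_k is entry k - 1 of the row vector y for
   1 <= k <= n, and y_(n+1) = 1 (the default value of nth). *)
Definition node {R : realType} (n : nat) (y : 'rV[R]_n) (k : nat) : R :=
  nth 1 (0 :: [seq y ord0 i | i <- enum 'I_n]) k.

Definition open_simplex {R : realType} (n : nat) : set 'rV[R]_n :=
  [set y | forall k : nat, (k <= n)%N -> node y k < node y k.+1].

Definition closed_simplex {R : realType} (n : nat) : set 'rV[R]_n :=
  [set y | forall k : nat, (k <= n)%N -> node y k <= node y k.+1].

Section SumOfTranslates.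
Context {R : realType} (n : nat) (K : R -> R) (J : R -> \bar R) (r : 'rV[R]_n).
Implicit Type y : 'rV[R]_n.

Definition sum_of_translates y (t : R) : \bar R :=
  (J t + \sum_(j < n) (r ord0 j)%:E * kext K (t - y ord0 j))%E.

Definition interval_max y (j : 'I_n.+1) : \bar R :=
  ereal_sup [set sum_of_translates y t | t in `[node y j, node y j.+1]].

Definition overall_max y : \bar R := \big[maxe/-oo%E]_(j < n.+1) interval_max y j.

Definition minimax_value : \bar R :=
  ereal_inf [set overall_max x | x in @closed_simplex R n].

Definition minimum_point y : Prop :=
  closed_simplex y /\ overall_max y = minimax_value.

Definition equioscillation_point y : Prop :=
  forall i j : 'I_n.+1, interval_max y i = interval_max y j.

Definition regularity_set : set 'rV[R]_n :=
  [set y | open_simplex y /\ forall j : 'I_n.+1, interval_max y j != -oo%E].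

End SumOfTranslates.

(* Main.v *)
Require Import Defs.
From mathcomp Require Import all_boot all_order all_algebra.
From mathcomp Require Import all_classical all_reals all_analysis.
From mathcomp Require Import zify lra ring.
Import Order.TTheory GRing.Theory Num.Theory.
Import numFieldNormedType.Exports.

Set Implicit Arguments.
Unset Strict Implicit.
Unset Printing Implicit Defensive.

Local Open Scope classical_set_scope.
Local Open Scope ring_scope.

(** For a node system w write F(w, t) for the sum of translates function and
    M for its supremum over t in [0, 1], which is the overall maximum of w.

    Existence.  The kernel, extended to [-1, 1], is continuous as a map into the
    extended reals ([kext_continuous_within]): strict concavity together with
    monotonicity makes it Lipschitz away from 0, and it tends to -oo at 0.
    Hence F(., t) is lower semicontinuous for each t, so is the supremum over t,
    and it attains its minimum on the compact closed simplex
    ([minimum_point_exists]).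

    Equioscillation.  Suppose that m_k(w) < M for some k.  Then w is not a
    minimum point ([overall_max_improvable]): spread the ends of the interval
    I_k apart, moving the node w_k to the left by e / r_k and w_{k+1} to the
    right by e / r_{k+1}.  If t lies outside the spread interval, all four
    differences between t and the old and new positions lie on the same side of
    0, so strict concavity gives that F strictly decreases at t
    ([concave_spread]).  If w_k = 0, or w_{k+1} = 1, that end stays fixed, and
    moving the other one lowers F on the only side that remains, because the
    kernel is monotone.  At the points of I_k itself F(w, t) <= m_k(w) < M, and
    upper semicontinuity of F in both variables keeps F below M near (w, t);
    singularity matters here, since it gives F = -oo at the nodes, which makes
    all this work right up to the ends of I_k and even when I_k is a single
    point.  Compactness of [0, 1] turns these local statements into one e that
    serves every t ([improvement]), and a supremum of an upper semicontinuous
    function over [0, 1] is attained, so the new overall maximum is strictly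
    less than M.  Nodes may coincide; then the first node of the cluster at w_k
    and the last node of the cluster at w_{k+1} are the ones to move, which
    preserves the order.

    Regularity.  The field is finite at more than n points, so at some point
    that is not a node, and M > -oo.  By equioscillation every m_k(w) equals M,
    whereas a degenerate interval I_k has m_k(w) = -oo. *)

(** * Strictly concave functions *)

(** A strictly concave function loses when two weighted points with fixed
    barycentre move apart: both inner points are convex combinations of the
    outer ones, and the balance condition makes the weights add up to q at x1
    and p at x4. *)
Lemma concave_spread {R : realType} (A : set R) (f : R -> R)
    (x1 x2 x3 x4 p q : R) :
  strictly_concave_on A f -> A x1 -> A x4 ->
  x1 < x2 -> x2 <= x3 -> x3 < x4 -> 0 < p -> 0 < q ->
  q * (x2 - x1) = p * (x4 - x3) ->
  q * f x1 + p * f x4 < q * f x2 + p * f x3.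
Proof.
move=> cf A1 A4 x12 x23 x34 p0 q0 bal.
have x14 : 0 < x4 - x1 by lra.
have x14n : x4 - x1 != 0 by rewrite gt_eqF.
have x1n4 : x1 != x4 by rewrite lt_eqF//; lra.
have bary x : x1 < x -> x < x4 ->
    (x4 - x) / (x4 - x1) * f x1 + (1 - (x4 - x) / (x4 - x1)) * f x4 < f x.
  move=> x1x xx4.
  have := cf x1 x4 ((x4 - x) / (x4 - x1)) A1 A4 x1n4.
  have -> : (x4 - x) / (x4 - x1) * x1 + (1 - (x4 - x) / (x4 - x1)) * x4 = x.
    by field.
  apply; apply/andP; split; first by rewrite divr_gt0//; lra.
  by rewrite ltr_pdivrMr//; lra.
have b2 := bary x2 x12 (le_lt_trans x23 x34).
have b3 := bary x3 (lt_le_trans x12 x23) x34.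
have e2 : q * ((x4 - x2) / (x4 - x1) * f x1 + (1 - (x4 - x2) / (x4 - x1)) * f x4)
   < q * f x2 by rewrite ltr_pM2l.
have e3 : p * ((x4 - x3) / (x4 - x1) * f x1 + (1 - (x4 - x3) / (x4 - x1)) * f x4)
   < p * f x3 by rewrite ltr_pM2l.
apply: le_lt_trans (ltrD e2 e3).
have -> : q * ((x4 - x2) / (x4 - x1) * f x1 + (1 - (x4 - x2) / (x4 - x1)) * f x4)
  + p * ((x4 - x3) / (x4 - x1) * f x1 + (1 - (x4 - x3) / (x4 - x1)) * f x4)
  = (q * (x4 - x2) + p * (x4 - x3)) / (x4 - x1) * (f x1 - f x4)
    + (q + p) * f x4 by field.
rewrite -bal -mulrDr (_ : x4 - x2 + (x2 - x1) = x4 - x1); last by ring.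
by rewrite mulfK//; lra.
Qed.

(** Chords of a concave function get less steep to the right, so the chord over
    [a / 2, a] bounds all the later ones.  This bound is uniform up to the end
    point 1, which gives both continuity and a finite limit there. *)
Lemma concave_slope_le {R : realType} (f : R -> R) (a s t : R) :
  strictly_concave_on `]0, 1[ f -> 0 < a -> a <= s -> s <= t -> t < 1 ->
  f t - f s <= (f a - f (a / 2)) / (a / 2) * (t - s).
Proof.
move=> cf a0 as_; rewrite le_eqVlt => /predU1P[<-|st] t1.
  by rewrite !subrr mulr0.
have a20 : 0 < a / 2 by lra.
rewrite mulrAC ler_pdivlMr// mulrC [leRHS]mulrC; apply: ltW.
have := @concave_spread R `]0, 1[ f (a / 2) a s t (a / 2) (t - s) cf.
rewrite /= !in_itv/= => h.
suff : (t - s) * f (a / 2) + a / 2 * f t < (t - s) * f a + a / 2 * f s by lra.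
by apply: h; lra.
Qed.

Section increasing_concave.
Context {R : realType} (f : R -> R).
Hypothesis cf : strictly_concave_on `]0, 1[ f.
Hypothesis mf : forall s t, 0 < s -> s < t -> t < 1 -> f s < f t.

Let mfW s t : 0 < s -> s <= t -> t < 1 -> f s <= f t.
Proof.
by move=> s0; rewrite le_eqVlt => /predU1P[->//|st] t1; apply/ltW/mf.
Qed.

Lemma increasing_concave_cvg (x : R) : 0 < x < 1 -> f z @[z --> x] --> f x.
Proof.
move=> /andP[x0 x1].
set L := (f (x / 2) - f (x / 2 / 2)) / (x / 2 / 2).
have lip s t : x / 2 <= s -> s <= t -> t < 1 -> f t - f s <= L * (t - s).
  by move=> *; apply: concave_slope_le => //; lra.
have L0 : 0 < L.
  by apply: divr_gt0; rewrite ?subr_gt0; [apply: mf|]; lra.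
apply/cvgrPdist_le => e e0.
near=> z.
have zx : `|x - z| <= e / L.
  near: z; apply: cvgr_dist_le; [exact: cvg_id|exact: divr_gt0].
have z1 : z < 1 by near: z; apply: cvgr_lt x1; exact: cvg_id.
have z0 : x / 2 < z by near: z; apply: (cvgr_gt _ cvg_id); lra.
suff h : `|f x - f z| <= L * `|x - z|.
  by rewrite (le_trans h)// mulrC -ler_pdivlMr.
case: (leP x z) => xz.
  have h1 := mfW x0 xz z1.
  rewrite distrC [X in _ <= _ * X]distrC ger0_norm ?ger0_norm ?subr_ge0//.
  by apply: lip => //; lra.
have h1 : f z <= f x by apply: mfW; lra.
by rewrite !ger0_norm ?subr_ge0 ?(ltW xz)//; apply: lip => //; lra.
Unshelve. all: end_near. Qed.

Lemma increasing_concave_is_cvg : cvg (f x @[x --> (1 : R)^'-]).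
Proof.
have nearh : \forall x \near (1 : R)^'-, 2^-1 < x < 1.
  near=> x; apply/andP; split; near: x; last exact: nbhs_left_lt.
  by apply: nbhs_left_gt; lra.
apply: nondecreasing_at_left_is_cvgr.
  apply: filterS nearh => x /andP[x0 x1] s t.
  rewrite !in_itv/= => /andP[xs s1] /andP[xt t1] st.
  by apply: mfW => //; lra.
apply: filterS nearh => x /andP[x0 x1].
set L := (f (2^-1) - f (2^-1 / 2)) / (2^-1 / 2).
have L0 : 0 < L.
  by apply: divr_gt0; rewrite ?subr_gt0; [apply: mf|]; lra.
exists (f (2^-1) + L) => _ [y /= + <-]; rewrite in_itv/= => /andP[xy y1].
have : f y - f (2^-1) <= L * (y - 2^-1).
  by apply: concave_slope_le => //; lra.
have : L * (y - 2^-1) <= L * 1 by rewrite ler_pM2l//; lra.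
lra.
Unshelve. all: end_near. Qed.
End increasing_concave.

(** * The extended kernel *)

Section kernel.
Context {R : realType} (K : R -> R).
Hypotheses (hK : kernel_function K) (hKsing : singular K).
Hypotheses (hKconc : strictly_concave K) (hKmono : strictly_monotone K).

Lemma kextE (t : R) : t != 0 -> t != -1 -> t != 1 -> kext K t = (K t)%:E.
Proof. by rewrite /kext => /negPf-> /negPf-> /negPf->. Qed.

(** The extension at 0 is defined through a limit operator that says something
    only once the two-sided limit is known to exist. *)
Lemma kext0_cvg : (K t)%:E @[t --> (0 : R)^'] --> -oo%E.
Proof.
have [_ _ [l [lr ll]]] := hK.
have h : (K t)%:E @[t --> (0 : R)^'] --> l.
  move=> P lP; have := lr P lP; have := ll P lP.
  rewrite /= !near_simpl !near_withinE.
  move=> h1 h2; near=> z => zn0.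
  have [z0|z0] : z < 0 \/ 0 < z by apply/orP; rewrite -neq_lt.
  - by move: z0; near: z.
  - by move: z0; near: z.
move: hKsing; rewrite /singular /kext eqxx => <-.
by rewrite (cvg_lim _ h).
Unshelve. all: end_near. Qed.

Lemma kernel_increasing (s t : R) : 0 < s -> s < t -> t < 1 -> K s < K t.
Proof.
move=> s0 st t1; have := hKmono.2 _ _ s0 st (ltW t1).
by rewrite !kextE ?lte_fin//; lra.
Qed.

(** The left branch of the kernel is studied through its reflection, which has
    the properties of the right branch. *)
Lemma reflected_kernel_increasing (s t : R) :
  0 < s -> s < t -> t < 1 -> K (- s) < K (- t).
Proof.
move=> s0 st t1; have := hKmono.1 (- t) (- s).
by rewrite !kextE ?lte_fin; try lra; apply; lra.
Qed.

Lemma reflected_kernel_concave : strictly_concave_on `]0, 1[ (K \o -%R).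
Proof.
move=> x y p; rewrite /= !in_itv/= => /andP[x0 x1] /andP[y0 y1] xy p01.
have := hKconc.1 (- x) (- y) p.
rewrite /= !in_itv/= eqr_opp => h.
have -> : - (p * x + (1 - p) * y) = p * - x + (1 - p) * - y by ring.
by apply: h => //; apply/andP; split; lra.
Qed.

Lemma kext1_cvg : exists2 l, kext K 1 = l%:E & K t @[t --> (1 : R)^'-] --> l.
Proof.
have c := increasing_concave_is_cvg hKconc.2 kernel_increasing.
exists (lim (K t @[t --> (1 : R)^'-])) => //.
rewrite /kext oner_eq0 eqxx [1 == -1]gt_eqF; last by lra.
by apply/cvg_lim => //; apply: cvg_EFin; [exact: nearW|].
Qed.

Lemma kextN1_cvg :
  exists2 l, kext K (-1) = l%:E & K t @[t --> (-1 : R)^'+] --> l.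
Proof.
have c := increasing_concave_is_cvg reflected_kernel_concave
  reflected_kernel_increasing.
have {}c : cvg (K t @[t --> (-1 : R)^'+]).
  by apply/cvg_ex; case/cvg_ex: c => l; exists l; apply/cvg_at_rightNP; rewrite opprK.
exists (lim (K t @[t --> (-1 : R)^'+])) => //.
rewrite /kext eqxx [-1 == 0]lt_eqF; last by lra.
by apply/cvg_lim => //; apply: cvg_EFin; [exact: nearW|].
Qed.

Lemma kext_fin (t : R) : t != 0 -> kext K t \is a fin_num.
Proof.
move=> t0; have [->|tN1] := eqVneq t (-1).
  by have [l ->] := kextN1_cvg.
have [->|t1] := eqVneq t 1; first by have [l ->] := kext1_cvg.
by rewrite kextE.
Qed.

Lemma kext_lty (t : R) : (kext K t < +oo)%E.
Proof.
have [->|t0] := eqVneq t 0; first by rewrite hKsing.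
by rewrite ltey_eq kext_fin.
Qed.

Lemma kernel_continuous (x : R) : -1 < x < 1 -> x != 0 ->
  K z @[z --> x] --> K x.
Proof.
move=> /andP[x1 x2] x0; have [xgt|xlt|x00] := ltgtP 0 x.
- apply: (increasing_concave_cvg hKconc.2 kernel_increasing).
  by apply/andP.
- have := @increasing_concave_cvg _ _ reflected_kernel_concave
    reflected_kernel_increasing (- x).
  move=> /(_ _)/= h.
  have {}h : K (- z) @[z --> - x] --> K (- - x) by apply: h; lra.
  rewrite opprK in h.
  have hN : - z @[z --> x] --> - x by apply: cvgN; exact: cvg_id.
  apply: cvg_trans (cvg_comp _ _ hN h).
  by apply: near_eq_cvg; apply: nearW => z /=; rewrite opprK.
- by rewrite -x00 eqxx in x0.
Qed.

(** Continuity of the extended kernel relative to [-1, 1], at the inner points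
    by concavity and at -1, 0 and 1 because its value there is the limit. *)
Lemma kext_continuous_within (x : R) (P : set (\bar R)) : -1 <= x <= 1 ->
  nbhs (kext K x) P -> \forall z \near x, -1 <= z <= 1 -> P (kext K z).
Proof.
move=> /andP[x1 x2] kP.
have Px : P (kext K x) := nbhs_singleton kP.
have [x0|x0] := eqVneq x 0.
  have := kext0_cvg; rewrite x0 in kP Px *; rewrite -hKsing => /(_ P kP).
  move=> h0; have h : \forall z \near (0 : R), z != 0 -> P (K z)%:E := h0.
  near=> z => _; have [->//|z0] := eqVneq z 0.
  rewrite kextE//.
  - by move: z0; near: z.
  - by rewrite gt_eqF//; near: z; apply: (cvgr_gt _ cvg_id); lra.
  - by rewrite lt_eqF//; near: z; apply: (cvgr_lt _ cvg_id); lra.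
have [xN1|xN1] := eqVneq x (-1).
  rewrite xN1 in kP Px *.
  have [l le kl] := kextN1_cvg.
  have : (K t)%:E @[t --> (-1 : R)^'+] --> l%:E.
    by apply: cvg_EFin => //; exact: nearW.
  rewrite -le => /(_ P kP) h0.
  have h : \forall z \near (-1 : R), -1 < z -> P (K z)%:E := h0.
  near=> z => /andP[]; rewrite le_eqVlt => /predU1P[<-//|z1] z2.
  have z0 : z < 0 by near: z; apply: (cvgr_lt _ cvg_id); lra.
  rewrite kextE; try lra.
  by move: z1; near: z.
have [x11|x11] := eqVneq x 1.
  rewrite x11 in kP Px *.
  have [l le kl] := kext1_cvg.
  have : (K t)%:E @[t --> (1 : R)^'-] --> l%:E.
    by apply: cvg_EFin => //; exact: nearW.
  rewrite -le => /(_ P kP) h0.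
  have h : \forall z \near (1 : R), z < 1 -> P (K z)%:E := h0.
  near=> z => /andP[z2]; rewrite le_eqVlt => /predU1P[->//|z1].
  have z0 : 0 < z by near: z; apply: (cvgr_gt _ cvg_id); lra.
  rewrite kextE; try lra.
  by move: z1; near: z.
have xK : K z @[z --> x] --> K x by apply: kernel_continuous; lra.
rewrite kextE// in kP.
have : (K z)%:E @[z --> x] --> (K x)%:E.
  by apply: cvg_EFin => //; exact: nearW.
move=> /(_ P kP) h0.
have h : \forall z \near x, P (K z)%:E := h0.
near=> z => _.
rewrite kextE; first by near: z.
- by near: z; apply: (@cvgr_neq0 _ R^o _ _ _ id x) => //; exact: cvg_id.
- by rewrite gt_eqF//; near: z; apply: (cvgr_gt _ cvg_id); lra.
- by rewrite lt_eqF//; near: z; apply: (cvgr_lt _ cvg_id); lra.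
Unshelve. all: end_near. Qed.

(** Clamping makes the extended kernel continuous on the whole line, so that
    limits of translates are plain compositions of limits. *)
Definition clamp (t : R) : R := Num.max (-1) (Num.min 1 t).

Lemma clampE (t : R) : -1 <= t <= 1 -> clamp t = t.
Proof.
by move=> /andP[t1 t2]; rewrite /clamp min_r// max_r.
Qed.

Lemma clamp_bound (t : R) : -1 <= clamp t <= 1.
Proof. by rewrite /clamp le_max lexx/= ge_max ge_min lexx/= andbT; lra. Qed.

Lemma kext_clamp_continuous : continuous (kext K \o clamp).
Proof.
move=> x P kP; have h := kext_continuous_within (clamp_bound x) kP.
have cc : clamp z @[z --> x] --> clamp x.
  apply: (@continuous_max R R (fun=> -1) (fun t => Num.min 1 t)).
    exact: cst_continuous.
  apply: (@continuous_min R R (fun=> 1) id); first exact: cst_continuous.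
  exact: cvg_id.
have hc : \forall z \near x, -1 <= clamp z <= 1 -> P (kext K (clamp z)) := cc _ h.
suff : \forall z \near x, P (kext K (clamp z)) by [].
apply: filterS hc => z; apply; exact: clamp_bound.
Qed.
End kernel.

(** * Semicontinuity and compactness *)

(** If no minimum were attained, then near each x in A the values of f would
    exceed some value f z, with z in A.  Compactness makes this uniform: some
    f y lies strictly below f on all of A, in particular at y.  Here the
    uniformity is along the filter of sublevels of values of f. *)
Lemma lsc_attains_min {T : topologicalType} {R : realType} (A : set T)
    (f : T -> \bar R) :
  compact A -> A !=set0 ->
  (forall x, A x -> forall a, (a < f x)%E ->
     \forall z \near x, A z -> (a < f z)%E) ->
  exists2 x, A x & forall z, A z -> (f x <= f z)%E.
Proof.
move=> cA [x0 Ax0] lscf; apply: contrapT => nomin.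
pose Phi : set_system (\bar R) :=
  filter_from (f @` A) (fun c => [set c' | (c' <= c)%E]).
have PhiF : Filter Phi.
  apply: filter_from_filter; first by exists (f x0), x0.
  move=> c d fc fd; exists (Order.min c d).
    by rewrite minEle; case: ifP.
  by move=> e /=; rewrite le_min => /andP[].
have cov := (near_covering_withinP A).2 ((compact_near_coveringP A).1 cA).
have := cov _ Phi (fun c x => (c < f x)%E) PhiF.
case=> [x Ax|_ [y Ay <-] h].
  have [z Az zx] : exists2 z, A z & (f z < f x)%E.
    apply: contrapT => noz; apply: nomin; exists x => // z Az.
    by rewrite leNgt; apply/negP => zx; apply: noz; exists z.
  exists ([set x' | A x' -> (f z < f x')%E], [set c | (c <= f z)%E]).
    split; first exact: lscf.
    by exists (f z) => //; exists z.
  by move=> [x' c] /= [h cz] Ax'; apply: le_lt_trans cz (h Ax').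
by have := h (f y) (lexx _) y Ay; rewrite ltxx.
Qed.

Lemma usc_attains_max {T : topologicalType} {R : realType} (A : set T)
    (f : T -> \bar R) :
  compact A -> A !=set0 ->
  (forall x, A x -> forall a, (f x < a)%E ->
     \forall z \near x, A z -> (f z < a)%E) ->
  exists2 x, A x & forall z, A z -> (f z <= f x)%E.
Proof.
move=> cA A0 uscf.
have [x Ax a|x Ax h] := @lsc_attains_min T R A (fun x => - f x)%E cA A0.
  rewrite lteNr => /(uscf x Ax); apply: filterS => z h Az.
  by rewrite lteNr; apply: h.
by exists x => // z /h; rewrite leeN2.
Qed.

Lemma cvg_esum {T I : Type} {R : realType} (F : set_system T) {FF : Filter F}
    (s : seq I) (f : I -> T -> \bar R) (a : I -> \bar R) :
  (forall i, (a i < +oo)%E) -> (forall i, f i z @[z --> F] --> a i) ->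
  (\sum_(i <- s) f i z @[z --> F] --> \sum_(i <- s) a i)%E.
Proof.
move=> ay fa; elim: s => [|i s IH].
  by rewrite big_nil; under eq_fun do rewrite big_nil; exact: cvg_cst.
rewrite big_cons; under eq_fun do rewrite big_cons.
apply: cvgeD => //; apply: ltpinfty_adde_def; rewrite inE//=.
by apply: lte_sum_pinfty => j _.
Qed.

(** What is needed for the sum of two upper semicontinuous functions to be upper
    semicontinuous, infinite values included. *)
Lemma lt_adde_split {R : realType} (a b c : \bar R) :
  (a < +oo)%E -> (b < +oo)%E -> (a + b < c)%E ->
  exists a' b' : R, [/\ (a < a'%:E)%E, (b < b'%:E)%E & ((a' + b')%:E <= c)%E].
Proof.
case: c => [c| |]; last by move=> _ _; rewrite ltNge leNye.
- case: a b => [a| |] [b| |]//= _ _; rewrite ?lte_fin => abc.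
  + exists (a + (c - (a + b)) / 2), (b + (c - (a + b)) / 2).
    by rewrite !lte_fin lee_fin; split; lra.
  + by exists (a + 1), (c - (a + 1)); rewrite lte_fin ltNyr lee_fin; split => //; lra.
  + by exists (c - (b + 1)), (b + 1); rewrite lte_fin ltNyr lee_fin; split => //; lra.
  + by exists c, 0; rewrite !ltNyr addr0.
- move=> aoo boo _.
  have above (x : \bar R) : (x < +oo)%E -> exists x' : R, (x < x'%:E)%E.
    case: x => [x _| |_] //; first by exists (x + 1); rewrite lte_fin ltrDl.
    by exists 0; rewrite ltNyr.
  have [a' aa'] := above a aoo; have [b' bb'] := above b boo.
  by exists a', b'; rewrite leey.
Qed.

(** * Nodes and the closed simplex *)

Section nodes.
Context {R : realType} (n : nat).
Implicit Type y : 'rV[R]_n.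

Lemma node0 y : node y 0 = 0.
Proof. by []. Qed.

Lemma nodeS y (j : 'I_n) : node y j.+1 = y ord0 j.
Proof.
by rewrite /node /= (nth_map j) ?size_enum_ord// nth_ord_enum.
Qed.

Lemma node_last y : node y n.+1 = 1.
Proof. by rewrite /node /= nth_default// size_map size_enum_ord. Qed.

Lemma node_mono y (k l : nat) :
  closed_simplex y -> (k <= l)%N -> (l <= n.+1)%N -> node y k <= node y l.
Proof.
move=> cy; elim: l => [|l IH]; first by rewrite leqn0 => /eqP->.
rewrite leq_eqVlt => /predU1P[->//|]; rewrite ltnS => kl ln.
exact: le_trans (IH kl (ltnW ln)) (cy l ln).
Qed.

Lemma node_bound y (k : nat) :
  closed_simplex y -> (k <= n.+1)%N -> 0 <= node y k <= 1.
Proof.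
move=> cy kn; rewrite -{1}(node0 y) -(node_last y).
by rewrite !node_mono.
Qed.

Definition unit_box : set 'rV[R]_n := [set y | forall j, 0 <= y ord0 j <= 1].

Lemma closed_simplex_box y : closed_simplex y -> unit_box y.
Proof. by move=> cy j; rewrite -nodeS node_bound// ltnS ltnW. Qed.

(** The interval is the first one whose right end is at least t. *)
Lemma node_interval_cover y (t : R) : 0 <= t <= 1 ->
  exists j : 'I_n.+1, node y j <= t <= node y j.+1.
Proof.
move=> /andP[t0 t1].
have ex : exists k, t <= node y k.+1 by exists n; rewrite node_last.
have kn : (ex_minn ex < n.+1)%N.
  by case: ex_minnP => k _ h; rewrite ltnS h// node_last.
exists (Ordinal kn) => /=; case: ex_minnP => -[|k] tk h {kn}.
  by rewrite node0 t0 tk.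
rewrite tk andbT leNgt; apply/negP => /ltW /h; by rewrite ltnn.
Qed.

Lemma node_continuous (k : nat) : continuous (fun y => node y k).
Proof.
case: k => [|k]; first exact: cst_continuous.
have [kn|kn] := ltnP k n.
  have -> : (fun y => node y k.+1) = (fun y => y ord0 (Ordinal kn)).
    by apply/funext => y; rewrite -nodeS.
  exact: coord_continuous.
have -> : (fun y => node y k.+1) = cst 1.
  by apply/funext => y; rewrite /node/= nth_default// size_map size_enum_ord.
exact: cst_continuous.
Qed.

Lemma closed_simplex_compact : compact (@closed_simplex R n).
Proof.
apply: (@subclosed_compact _ _ [set y : 'rV[R]_n | forall i, `[0, 1]%classic (y ord0 i)]).
- have -> : @closed_simplex R n =
      \bigcap_(k in [set k | (k <= n)%N]) [set y | node y k <= node y k.+1].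
    by apply/seteqP; split.
  apply: closed_bigI => k _.
  have -> : [set y : 'rV[R]_n | node y k <= node y k.+1] =
      (fun y => node y k.+1 - node y k) @^-1` [set x | 0 <= x].
    by apply/seteqP; split => y /=; rewrite subr_ge0.
  apply: closed_comp; last exact: closed_ge.
  by move=> y _; exact: cvgB (@node_continuous k.+1 y) (@node_continuous k y).
- by apply: (@rV_compact R n (fun=> `[0, 1]%classic)) => i; exact: segment_compact.
- by move=> y /closed_simplex_box h i; rewrite /= in_itv/= h.
Qed.

Lemma closed_simplex_nonempty : @closed_simplex R n !=set0.
Proof.
exists (const_mx 1) => k kn.
have h j : (0 < j)%N -> node (const_mx 1 : 'rV[R]_n) j = 1.
  case: j => // j _; have [jn|jn] := ltnP j n.
    by rewrite (nodeS _ (Ordinal jn)) mxE.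
  by rewrite /node/= nth_default// size_map size_enum_ord.
by case: k kn => [|k] kn; rewrite ?node0 !h// ler01.
Qed.
End nodes.

(** * Moving the nodes *)

Section perturbation.
Context {R : realType} (n : nat).
Implicit Types w d : 'rV[R]_n.

(** Nodes may coincide, and only the last one of a group of equal nodes has room
    on its right. *)
Lemma cluster_last w (k : nat) : closed_simplex w -> (k <= n)%N ->
  node w k.+1 < 1 ->
  exists j : 'I_n, [/\ (k <= j)%N, node w j.+1 = node w k.+1 &
    node w j.+1 < node w j.+2].
Proof.
move=> cw kn; have [m] := ubnP (n - k); elim: m k kn => // m IH k kn nk w1.
have {}kn : (k < n)%N.
  rewrite ltn_neqAle kn andbT; apply/negP => /eqP kn'.
  by move: w1; rewrite kn' node_last ltxx.
have := cw k.+1 kn; rewrite le_eqVlt => /predU1P[e|lt].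
  have [||j [kj jk lt]] := IH k.+1 kn; [by rewrite subnS; lia|by rewrite -e|].
  by exists j; rewrite jk -e; split => //; [exact: ltnW|rewrite e -jk].
by exists (Ordinal kn).
Qed.

(** Likewise only the first one of a group of equal nodes has room on its
    left. *)
Lemma cluster_first w (k : nat) : closed_simplex w -> (k <= n)%N ->
  0 < node w k ->
  exists i : 'I_n, [/\ (i < k)%N, node w i.+1 = node w k & node w i < node w i.+1].
Proof.
move=> cw; elim: k => [|k IH] kn w0; first by rewrite node0 ltxx in w0.
have := cw k (ltnW kn); rewrite le_eqVlt => /predU1P[e|lt].
  have [||i [ik ie lt]] := IH; [exact: ltnW|by rewrite e|].
  by exists i; rewrite -e; split => //; exact: ltnW.
by exists (Ordinal kn).
Qed.

(** The derivative of the extended nodes along d: the end nodes 0 and 1 do not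
    move. *)
Definition node_velocity d (k : nat) : R :=
  nth 0 (0 :: [seq d ord0 i | i <- enum 'I_n]) k.

Lemma node_velocityS d (j : 'I_n) : node_velocity d j.+1 = d ord0 j.
Proof.
by rewrite /node_velocity /= (nth_map j) ?size_enum_ord// nth_ord_enum.
Qed.

Lemma node_velocity_last d : node_velocity d n.+1 = 0.
Proof. by rewrite /node_velocity /= nth_default// size_map size_enum_ord. Qed.

Lemma node_shift w d (e : R) (k : nat) :
  (k <= n.+1)%N -> node (w + e *: d) k = node w k + e * node_velocity d k.
Proof.
case: k => [|k]; first by rewrite !node0 mulr0 addr0.
rewrite ltnS leq_eqVlt => /predU1P[->|kn].
  by rewrite !node_last node_velocity_last mulr0 addr0.
by rewrite (node_velocityS _ (Ordinal kn)) !(nodeS _ (Ordinal kn)) !mxE.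
Qed.

(** A short move preserves the order of the nodes: strict gaps survive, and
    across an empty gap the left node does not move to the right nor the right
    node to the left. *)
Lemma closed_simplex_shift w d : closed_simplex w ->
  (forall j : 'I_n, 0 < d ord0 j -> node w j.+1 < node w j.+2) ->
  (forall j : 'I_n, d ord0 j < 0 -> node w j < node w j.+1) ->
  \forall e \near (0 : R)^'+, closed_simplex (w + e *: d).
Proof.
move=> cw hpos hneg.
suff : \forall e \near (0 : R)^'+, forall k : 'I_n.+1,
    node (w + e *: d) k <= node (w + e *: d) k.+1.
  by apply: filterS => e h k kn; exact: (h (Ordinal (kn : (k < n.+1)%N))).
apply: filter_forall => -[k /= kn].
have := cw k kn; rewrite le_eqVlt => /predU1P[eqk|ltk].
  have vk : node_velocity d k <= 0.
    case: k kn eqk => // k kn eqk.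
    rewrite (node_velocityS _ (Ordinal (kn : (k < n)%N))) leNgt; apply/negP.
    by move=> /hpos /=; rewrite eqk ltxx.
  have vk1 : 0 <= node_velocity d k.+1.
    move: kn; rewrite ltnS leq_eqVlt => /predU1P[->|kn'].
      by rewrite node_velocity_last.
    rewrite (node_velocityS _ (Ordinal kn')) leNgt; apply/negP.
    by move=> /hneg /=; rewrite eqk ltxx.
  near=> e; have e0 : 0 <= e by near: e; exact: nbhs_right_ge.
  rewrite !node_shift//; last exact: ltnW.
  rewrite eqk lerD2l (@le_trans _ _ 0)//; first by rewrite mulr_ge0_le0.
  exact: mulr_ge0.
(* The gap shrinks at a rate less than v; adding 1 makes v positive. *)
set v := `|node_velocity d k - node_velocity d k.+1| + 1.
have v0 : 0 < v by rewrite ltr_wpDl.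
near=> e; have e0 : 0 < e by near: e; exact: nbhs_right_gt.
have ev : e < (node w k.+1 - node w k) / v.
  by near: e; apply: nbhs_right_lt; rewrite divr_gt0// subr_gt0.
rewrite !node_shift//; last exact: ltnW.
have h1 : e * (node_velocity d k - node_velocity d k.+1) <= e * v.
  by rewrite ler_pM2l// /v; have := ler_norm (node_velocity d k - node_velocity d k.+1); lra.
have h2 : e * v < node w k.+1 - node w k by rewrite -ltr_pdivlMr.
lra.
Unshelve. all: end_near. Qed.
End perturbation.

(** * The sum of translates function *)

Section sum_of_translates.
Context {R : realType} (n : nat) (K : R -> R) (J : R -> \bar R) (r : 'rV[R]_n).
Hypotheses (hK : kernel_function K) (hKsing : singular K).
Hypotheses (hKconc : strictly_concave K) (hKmono : strictly_monotone K).
Hypotheses (hJ : field_function n J) (hJusc : upper_semicontinuous_on `[0, 1] J).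
Hypothesis hr : forall j : 'I_n, 0 < r ord0 j.

Local Notation F := (sum_of_translates K J r).
Local Notation mbar := (overall_max K J r).

Lemma field_lty (t : R) : 0 <= t <= 1 -> (J t < +oo)%E.
Proof. by move=> t01; have [[M /(_ t t01) h] _] := hJ; exact: le_lt_trans h (ltry _). Qed.

Lemma field_usc (t a : R) : 0 <= t <= 1 -> (J t < a%:E)%E ->
  \forall s \near t, 0 <= s <= 1 -> (J s < a%:E)%E.
Proof.
move=> t01 Jta.
have [|V /= tV h] := hJusc (x := t) (a := - a); first by rewrite EFinN lteN2.
have : within `[0, 1] (nbhs t) V.
  by rewrite nbhs_subspace_in//= in_itv.
rewrite /within/= near_simpl; apply: filterS => s sV s01.
by have := h s (sV _); rewrite EFinN lteN2; apply; rewrite in_itv.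
Qed.

Lemma term_lty (j : 'I_n) (x : R) : ((r ord0 j)%:E * kext K x < +oo)%E.
Proof.
have := kext_lty hKsing hKconc hKmono x.
case: (kext K x) => // [z _|_]; first by rewrite -EFinM ltry.
by rewrite mulrNy gtr0_sg// mul1e.
Qed.

(** Stated along an arbitrary filter so as to serve several limits: t alone
    moves, the nodes alone move, or t moves together with the length of a
    shift.  The sum is continuous because no term takes the value +oo. *)
Lemma translates_cvg {T : Type} (Phi : set_system T) {FPhi : Filter Phi}
    (Y : T -> 'rV[R]_n) (S : T -> R) (y : 'rV[R]_n) (t : R) :
  (\forall z \near Phi, unit_box (Y z) /\ 0 <= S z <= 1) ->
  unit_box y -> 0 <= t <= 1 ->
  (forall j, Y z ord0 j @[z --> Phi] --> y ord0 j) -> S @ Phi --> t ->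
  (\sum_(j < n) (r ord0 j)%:E * kext K (S z - Y z ord0 j) @[z --> Phi] -->
   \sum_(j < n) (r ord0 j)%:E * kext K (t - y ord0 j))%E.
Proof.
move=> inbox ybox t01 Yy St.
apply: cvg_esum => j; first exact: term_lty.
apply: cvgeZl => //.
have d1 : S z - Y z ord0 j @[z --> Phi] --> t - y ord0 j by exact: cvgB.
have := cvg_comp _ _ d1 (@kext_clamp_continuous _ _ hK hKsing hKconc hKmono _).
rewrite /= clampE; last by have := ybox j; lra.
apply: cvg_trans; apply: near_eq_cvg; apply: filterS inbox => z [/(_ j) h1 h2].
by rewrite /= clampE//; lra.
Qed.

(** The kernel part is continuous and J is upper semicontinuous; neither takes
    the value +oo. *)
Lemma sum_of_translates_usc {T : Type} (Phi : set_system T) {FPhi : Filter Phi}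
    (Y : T -> 'rV[R]_n) (S : T -> R) (y : 'rV[R]_n) (t : R) (c : \bar R) :
  (\forall z \near Phi, unit_box (Y z) /\ 0 <= S z <= 1) ->
  unit_box y -> 0 <= t <= 1 ->
  (forall j, Y z ord0 j @[z --> Phi] --> y ord0 j) -> S @ Phi --> t ->
  (F y t < c)%E -> \forall z \near Phi, (F (Y z) (S z) < c)%E.
Proof.
move=> inbox ybox t01 Yy St.
case/lt_adde_split; [exact: field_lty|by apply: lte_sum_pinfty => j _; exact: term_lty|].
move=> a [b [Ja Gb abc]].
have h1 : \forall z \near Phi,
    (\sum_(j < n) (r ord0 j)%:E * kext K (S z - Y z ord0 j) < b%:E)%E.
  exact: (translates_cvg inbox ybox t01 Yy St (open_ereal_lt' Gb)).
have h2 : \forall z \near Phi, 0 <= S z <= 1 -> (J (S z) < a%:E)%E :=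
  St _ (field_usc t01 Ja).
near=> z.
have [_ S01] : unit_box (Y z) /\ 0 <= S z <= 1 by near: z.
have Js : (J (S z) < a%:E)%E by move: S01; near: z.
have Gs : (\sum_(j < n) (r ord0 j)%:E * kext K (S z - Y z ord0 j) < b%:E)%E.
  by near: z.
exact: lt_le_trans (lteD Js Gs) abc.
Unshelve. all: end_near. Qed.

Lemma sum_of_translates_lsc (y : 'rV[R]_n) (t : R) (c : \bar R) :
  unit_box y -> 0 <= t <= 1 -> (c < F y t)%E ->
  \forall x \near y, unit_box x -> (c < F x t)%E.
Proof.
move=> ybox t01 cF.
suff h : F x t @[x --> within (@unit_box R n) (nbhs y)] --> F y t.
  exact: (h _ (open_ereal_gt' cF)).
apply: cvgeD; [|exact: cvg_cst|].
  apply: ltpinfty_adde_def; rewrite inE/=; first exact: field_lty.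
  by apply: lte_sum_pinfty => j _; exact: term_lty.
apply: (@translates_cvg _ _ _ id (fun=> t)) => //.
- by apply: filterS (withinT _ _) => x.
- move=> j; apply: cvg_within_filter; exact: coord_continuous.
- exact: cvg_cst.
Qed.

Lemma sum_of_translates_le_max (y : 'rV[R]_n) (t : R) :
  0 <= t <= 1 -> (F y t <= mbar y)%E.
Proof.
move=> /(node_interval_cover y)[j yj].
apply: le_trans (le_bigmax _ _ j); apply: ereal_sup_ubound.
by exists t => //; rewrite /= in_itv.
Qed.

Lemma interval_max_le (y : 'rV[R]_n) (c : \bar R) (j : 'I_n.+1) :
  closed_simplex y -> (forall t, 0 <= t <= 1 -> (F y t <= c)%E) ->
  (interval_max K J r y j <= c)%E.
Proof.
move=> cy h; apply: ge_ereal_sup => _ [t /= + <-].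
rewrite in_itv/= => /andP[t1 t2]; apply: h.
have b1 := node_bound cy (ltnW (ltn_ord j)).
have b2 := node_bound cy (ltn_ord j).
by lra.
Qed.

Lemma overall_max_le (y : 'rV[R]_n) (c : \bar R) : closed_simplex y ->
  (forall t, 0 <= t <= 1 -> (F y t <= c)%E) -> (mbar y <= c)%E.
Proof.
by move=> cy h; apply: bigmax_le => [|j _]; [exact: leNye|exact: interval_max_le].
Qed.

(** A strict pointwise bound passes to the supremum because an upper
    semicontinuous function attains it on [0, 1]. *)
Lemma overall_max_lt (y : 'rV[R]_n) (c : \bar R) : closed_simplex y ->
  (forall t, 0 <= t <= 1 -> (F y t < c)%E) -> (mbar y < c)%E.
Proof.
move=> cy h.
have I0 : `[0 : R, 1]%classic !=set0 by exists 0; rewrite /= in_itv/= lexx ler01.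
have [|t t01 tmax] := usc_attains_max (f := F y) (@segment_compact R 0 1) I0.
  move=> t; rewrite /= in_itv/= => t01 a Fa.
  have := @sum_of_translates_usc _ (within `[0, 1] (nbhs t)) _ (fun=> y) id
    y t a.
  have -> : (\forall z \near within `[0, 1] (nbhs t), (F y z < a)%E) =
    (\forall z \near t, `[0, 1]%classic z -> (F y z < a)%E) by [].
  apply => //.
  - apply: filterS (withinT _ _) => z.
    by rewrite /= in_itv/= => ?; split=> //; exact: closed_simplex_box.
  - exact: closed_simplex_box.
  - by move=> j; exact: cvg_cst.
  - exact: cvg_within.
rewrite /= in_itv/= in t01; apply: le_lt_trans (h t t01).
by apply: overall_max_le => // s s01; apply: tmax; rewrite /= in_itv.
Qed.

(** The weights are at most 1, so J is finite at more than n points, hence at a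
    point that is not a node, where F is finite. *)
Lemma overall_max_gtNy (y : 'rV[R]_n) : (-oo < mbar y)%E.
Proof.
have [_ [s [us sJ sn]]] := hJ.
have ns : (n < size s)%N.
  rewrite -(ltr_nat R); apply: lt_le_trans sn _.
  rewrite -sum1_size natr_sum; apply: ler_sum => t _.
  by case: ifP => _ //; rewrite invf_le1 ?ler1n.
have [t ts ty] : exists2 t, t \in s & t \notin [seq y ord0 j | j <- enum 'I_n].
  apply: contrapT => no; move: ns; rewrite ltnNge => /negP; apply.
  rewrite -[leqRHS]size_enum_ord -(size_map (fun j => y ord0 j)).
  apply: uniq_leq_size => // t ts; apply/negP => ty.
  by apply: no; exists t => //; apply/negP.
have [t01 Jt] := sJ t ts.
apply: lt_le_trans (sum_of_translates_le_max y t01).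
suff Ffin : F y t \is a fin_num by rewrite -(fineK Ffin) ltNyr.
rewrite fin_numD Jt/=; apply/sum_fin_numP => j _ _.
rewrite fin_numM//; apply: (kext_fin hKconc hKmono).
by rewrite subr_eq0; apply: contra ty => /eqP->; apply: map_f; rewrite mem_enum.
Qed.

(** A supremum of lower semicontinuous functions of the nodes, one for each t,
    is lower semicontinuous. *)
Lemma minimum_point_exists : exists w, minimum_point K J r w.
Proof.
have [|w cw wmin] := lsc_attains_min (f := fun y => mbar y)
  (@closed_simplex_compact R n) (@closed_simplex_nonempty R n).
  move=> x cx a amx.
  have [t t01 aF] : exists2 t, 0 <= t <= 1 & (a < F x t)%E.
    apply: contrapT => no; move: amx; rewrite ltNge => /negP; apply.
    apply: overall_max_le => // t t01; rewrite leNgt; apply/negP => aF.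
    by apply: no; exists t.
  have := sum_of_translates_lsc (closed_simplex_box cx) t01 aF.
  apply: filterS => z h cz.
  exact: lt_le_trans (h (closed_simplex_box cz)) (sum_of_translates_le_max _ t01).
exists w; split => //; apply/eqP; rewrite eq_le; apply/andP; split.
  by apply: le_ereal_inf_tmp => _ [y cy <-]; exact: wmin.
by apply: ereal_inf_lbound; exists w.
Qed.

Lemma sum_of_translates_node (y : 'rV[R]_n) (j : 'I_n) :
  F y (y ord0 j) = -oo%E.
Proof.
apply/eqP; rewrite adde_eq_ninfty; apply/orP; right.
rewrite esum_eqNy; apply/existsP; exists j; rewrite subrr hKsing/=.
by rewrite mulrNy gtr0_sg// mul1e.
Qed.

(** Since the end nodes 0 and 1 differ, one end of a degenerate interval is the
    position of an actual translate, which is singular there. *)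
Lemma interval_max_degenerate (y : 'rV[R]_n) (k : 'I_n.+1) :
  node y k = node y k.+1 -> interval_max K J r y k = -oo%E.
Proof.
move=> yk; have [j yj] : exists j, node y k = y ord0 j.
  case: k yk => -[|k] /= kn yk.
    have [n0|n0] := posnP n; last by exists (Ordinal n0); rewrite yk -nodeS.
    have y1 : node y 1 = 1 by rewrite -(node_last y); congr (node y _.+1).
    by move/eqP: yk; rewrite node0 y1 eq_sym oner_eq0.
  by exists (Ordinal (kn : (k < n)%N)); rewrite -nodeS.
apply/eqP; rewrite eq_le leNye andbT; apply: ge_ereal_sup => _ [t /= + <-].
by rewrite in_itv/= -yk => /le_anti<-; rewrite yj sum_of_translates_node.
Qed.

(** Reduces comparison of two node systems at s to real sums.  The value 0 that
    [fine] gives to -oo does no harm: a node equal to s in both systems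
    contributes the same to both sums, and then F x s = -oo anyway. *)
Lemma sum_of_translates_lt (w x : 'rV[R]_n) (s : R) (M : \bar R) :
  0 <= s <= 1 -> (-oo < M)%E -> (F w s <= M)%E ->
  (forall j, x ord0 j != w ord0 j -> s != w ord0 j) ->
  \sum_(j < n) r ord0 j * fine (kext K (s - x ord0 j)) <
    \sum_(j < n) r ord0 j * fine (kext K (s - w ord0 j)) ->
  (F x s < M)%E.
Proof.
move=> s01 M0 FM sw lts.
have [Js|Js] := boolP (J s \is a fin_num); last first.
  have -> : F x s = -oo%E.
    have := field_lty s01; move: Js; rewrite /sum_of_translates.
    by case: (J s).
  exact: M0.
have [/forallP sx|] := boolP [forall j, s != x ord0 j]; last first.
  rewrite negb_forall => /existsP[j]; rewrite negbK => /eqP->.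
  by rewrite sum_of_translates_node.
have real (y : 'rV[R]_n) : (forall j, s != y ord0 j) -> F y s =
    (fine (J s) + \sum_(j < n) r ord0 j * fine (kext K (s - y ord0 j)))%:E.
  move=> sy; rewrite EFinD fineK// -sumEFin; congr (_ + _)%E.
  apply: eq_bigr => j _; rewrite EFinM fineK//.
  by apply: (kext_fin hKconc hKmono); rewrite subr_eq0.
have swj j : s != w ord0 j.
  by have [<-//|/sw] := eqVneq (x ord0 j) (w ord0 j).
apply: lt_le_trans FM; rewrite !real//.
by rewrite lte_fin ltrD2l.
Qed.

(** The compactness argument: pointwise reasons for F to fall below M after a
    short move along d yield one move that works for every t.  Where F is
    already below M, semicontinuity is such a reason. *)
Lemma improvement (w d : 'rV[R]_n) (M : \bar R) : closed_simplex w ->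
  (forall j : 'I_n, 0 < d ord0 j -> node w j.+1 < node w j.+2) ->
  (forall j : 'I_n, d ord0 j < 0 -> node w j < node w j.+1) ->
  (forall t, 0 <= t <= 1 -> (F w t < M)%E \/
     \forall s \near t & e \near (0 : R)^'+, 0 <= s <= 1 ->
       (F (w + e *: d) s < M)%E) ->
  exists2 y, closed_simplex y & (mbar y < M)%E.
Proof.
move=> cw hpos hneg hF.
have simp := closed_simplex_shift cw hpos hneg.
have cov := (near_covering_withinP _).2
  ((compact_near_coveringP _).1 (@segment_compact R 0 1)).
have {}cov := cov _ (0 : R)^'+ (fun e s => (F (w + e *: d) s < M)%E) _.
have : \forall e \near (0 : R)^'+, `[0, 1] `<=` (fun s => (F (w + e *: d) s < M)%E).
  apply: cov => t; rewrite /= in_itv/= => t01.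
  case: (hF t t01) => [FM|h]; last first.
    by apply: filterS h => -[s e] /= h; rewrite in_itv/=.
  pose Phi := within [set p : R * R | closed_simplex (w + p.2 *: d) /\ 0 <= p.1 <= 1]
     (filter_prod (nbhs t) (0 : R)^'+).
  have h : \forall p \near Phi, (F (w + p.2 *: d) p.1 < M)%E.
    apply: (sum_of_translates_usc (y := w) (t := t)) => //.
    - apply: filterS (withinT _ _) => p [cp p01]; split => //.
      exact: closed_simplex_box.
    - exact: closed_simplex_box.
    - move=> j; apply: cvg_within_filter.
      have p2 : p.2 @[p --> filter_prod (nbhs t) (0 : R)^'+] --> (0 : R).
        apply: (cvg_trans cvg_snd) => P P0.
        have h : nbhs (0 : R) (fun e => 0 < e -> P e) by apply: filterS P0 => e Pe _.
        exact: h.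
      have h : w ord0 j + p.2 * d ord0 j @[p --> filter_prod (nbhs t) (0 : R)^'+]
          --> w ord0 j + 0 * d ord0 j.
        by apply: cvgD; [exact: cvg_cst|apply: cvgM => //; exact: cvg_cst].
      rewrite mul0r addr0 in h; apply: (cvg_trans _ h); apply: near_eq_cvg.
      by apply: nearW => p /=; rewrite !mxE.
    - apply: cvg_within_filter; exact: cvg_fst.
  have h2 : \forall p \near filter_prod (nbhs t) (0 : R)^'+,
      closed_simplex (w + p.2 *: d).
    exact: (cvg_snd simp).
  have {}h : \forall p \near filter_prod (nbhs t) (0 : R)^'+,
      closed_simplex (w + p.2 *: d) /\ 0 <= p.1 <= 1 ->
      (F (w + p.2 *: d) p.1 < M)%E := h.
  apply: filterS2 h h2 => -[s e] /= h cs; rewrite in_itv/= => s01.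
  by apply: h.
move=> h.
have [e [ce he]] := filter_ex (filterI simp h).
exists (w + e *: d) => //.
exact: overall_max_lt.
Qed.

(** The kernel increases on (0, 1], so to the right of a node the translate
    decreases when the node approaches. *)
Lemma shift_right_lower (w : 'rV[R]_n) (j : 'I_n) (M : \bar R) (t : R) :
  closed_simplex w -> (-oo < M)%E ->
  (forall s, 0 <= s <= 1 -> (F w s <= M)%E) -> w ord0 j < t ->
  \forall s \near t & e \near (0 : R)^'+, 0 <= s <= 1 ->
    (F (w + e *: delta_mx ord0 j) s < M)%E.
Proof.
move=> cw M0 FM wt.
have [wj0 wj1] := andP (closed_simplex_box cw j).
near=> s e => /= s01.
have e0 : 0 < e by near: e; exact: nbhs_right_gt.
have et : e < (t - w ord0 j) / 2.
  by near: e; apply: nbhs_right_lt; lra.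
have st : (t + w ord0 j) / 2 < s.
  by near: s; apply: (cvgr_gt _ cvg_id); lra.
have xE l : (w + e *: delta_mx ord0 j) ord0 l = w ord0 l + e * (l == j)%:R.
  by rewrite !mxE eqxx.
apply: (sum_of_translates_lt (w := w)) => //.
- exact: FM.
- move=> l; rewrite xE; have [->|_] := eqVneq l j.
    by rewrite mulr1 => _; rewrite gt_eqF//; lra.
  by rewrite mulr0 addr0 eqxx.
rewrite (bigD1 j)//= [ltRHS](bigD1 j)//=.
rewrite (eq_bigr (fun l => r ord0 l * fine (kext K (s - w ord0 l)))); last first.
  by move=> l /negPf lj; rewrite xE lj mulr0 addr0.
rewrite ltrD2r ltr_pM2l// xE eqxx mulr1 fine_lt ?(kext_fin hKconc hKmono)//.
- by rewrite gt_eqF//; lra.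
- by rewrite gt_eqF//; lra.
- by apply: hKmono.2; lra.
Unshelve. all: end_near. Qed.

(** The kernel decreases on [-1, 0), so to the left of a node the translate
    decreases when the node approaches. *)
Lemma shift_left_lower (w : 'rV[R]_n) (i : 'I_n) (M : \bar R) (t : R) :
  closed_simplex w -> (-oo < M)%E ->
  (forall s, 0 <= s <= 1 -> (F w s <= M)%E) -> t < w ord0 i ->
  \forall s \near t & e \near (0 : R)^'+, 0 <= s <= 1 ->
    (F (w + e *: - delta_mx ord0 i) s < M)%E.
Proof.
move=> cw M0 FM wt.
have [wj0 wj1] := andP (closed_simplex_box cw i).
near=> s e => /= s01.
have e0 : 0 < e by near: e; exact: nbhs_right_gt.
have et : e < (w ord0 i - t) / 2.
  by near: e; apply: nbhs_right_lt; lra.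
have st : s < (t + w ord0 i) / 2.
  by near: s; apply: (cvgr_lt _ cvg_id); lra.
have xE l : (w + e *: - delta_mx ord0 i) ord0 l = w ord0 l - e * (l == i)%:R.
  by rewrite !mxE eqxx mulrN.
apply: (sum_of_translates_lt (w := w)) => //.
- exact: FM.
- move=> l; rewrite xE; have [->|_] := eqVneq l i.
    by rewrite mulr1 => _; rewrite lt_eqF//; lra.
  by rewrite mulr0 subr0 eqxx.
rewrite (bigD1 i)//= [ltRHS](bigD1 i)//=.
rewrite (eq_bigr (fun l => r ord0 l * fine (kext K (s - w ord0 l)))); last first.
  by move=> l /negPf lj; rewrite xE lj mulr0 subr0.
rewrite ltrD2r ltr_pM2l// xE eqxx mulr1 fine_lt ?(kext_fin hKconc hKmono)//.
- by rewrite lt_eqF//; lra.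
- by rewrite lt_eqF//; lra.
- by apply: hKmono.1; lra.
Unshelve. all: end_near. Qed.

(** Speeds inversely proportional to the weights keep the weighted barycentre of
    the two nodes fixed, as [concave_spread] requires. *)
Definition spread_direction (i j : 'I_n) : 'rV[R]_n :=
  (r ord0 j)^-1 *: delta_mx ord0 j - (r ord0 i)^-1 *: delta_mx ord0 i.

Lemma spread_directionE (i j l : 'I_n) :
  spread_direction i j ord0 l =
  (r ord0 j)^-1 * (l == j)%:R - (r ord0 i)^-1 * (l == i)%:R.
Proof. by rewrite !mxE eqxx. Qed.

(** For t to the right of both nodes all arguments of the kernel lie in (0, 1),
    for t to the left in (-1, 0): the room 0 < w_i and w_j < 1 keeps them away
    from the end points. *)
Lemma spread_lower (w : 'rV[R]_n) (i j : 'I_n) (M : \bar R) (t : R) :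
  (-oo < M)%E -> (forall s, 0 <= s <= 1 -> (F w s <= M)%E) ->
  i != j -> 0 < w ord0 i -> w ord0 i <= w ord0 j -> w ord0 j < 1 ->
  t < w ord0 i \/ w ord0 j < t ->
  \forall s \near t & e \near (0 : R)^'+, 0 <= s <= 1 ->
    (F (w + e *: spread_direction i j) s < M)%E.
Proof.
move=> M0 FM ij wi0 wij wj1 tout.
have [ri rj] := (hr i, hr j).
have small (c : R) : 0 < c ->
    \forall e \near (0 : R)^'+, e / r ord0 i < c /\ e / r ord0 j < c.
  move=> c0; near=> e; rewrite !ltr_pdivrMr//; split; near: e.
    by apply: nbhs_right_lt; exact: mulr_gt0.
  by apply: nbhs_right_lt; exact: mulr_gt0.
have sides : \forall s \near t & e \near (0 : R)^'+,
    s < w ord0 i - e / r ord0 i \/ w ord0 j + e / r ord0 j < s.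
  case: tout => [ti|tj]; near=> s e => /=; [left|right].
    have st : s < (t + w ord0 i) / 2.
      by near: s; apply: (cvgr_lt _ cvg_id); lra.
    have [] : e / r ord0 i < (w ord0 i - t) / 2 /\ e / r ord0 j < (w ord0 i - t) / 2.
      by near: e; apply: small; lra.
    by lra.
  have st : (t + w ord0 j) / 2 < s.
    by near: s; apply: (cvgr_gt _ cvg_id); lra.
  have [] : e / r ord0 i < (t - w ord0 j) / 2 /\ e / r ord0 j < (t - w ord0 j) / 2.
    by near: e; apply: small; lra.
  by lra.
have room : \forall e \near (0 : R)^'+,
    [/\ 0 < e, e / r ord0 i < w ord0 i & e / r ord0 j < 1 - w ord0 j].
  near=> e; split; near: e.
  - exact: nbhs_right_gt.
  - by apply: filterS (small _ wi0) => e [].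
  - by have wj1' : 0 < 1 - w ord0 j; [lra|apply: filterS (small _ wj1') => e []].
have {}room : \forall p \near filter_prod (nbhs t) (0 : R)^'+,
    [/\ 0 < p.2, p.2 / r ord0 i < w ord0 i & p.2 / r ord0 j < 1 - w ord0 j].
  exact: (cvg_snd room).
apply: filterS2 sides room => -[s e] /= ss [e0 awi bwj] s01.
pose a := e / r ord0 i; pose b := e / r ord0 j.
have a0 : 0 < a by exact: divr_gt0.
have b0 : 0 < b by exact: divr_gt0.
have xi : (w + e *: spread_direction i j) ord0 i = w ord0 i - a.
  by rewrite 2!mxE spread_directionE eqxx (negPf ij) mulr0 sub0r mulr1 mulrN.
have xj : (w + e *: spread_direction i j) ord0 j = w ord0 j + b.
  by rewrite 2!mxE spread_directionE eqxx eq_sym (negPf ij) mulr0 subr0 mulr1.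
have xl l : l != i -> l != j ->
    (w + e *: spread_direction i j) ord0 l = w ord0 l.
  move=> /negPf li /negPf lj.
  by rewrite 2!mxE spread_directionE li lj !mulr0 subrr mulr0 addr0.
rewrite -/a -/b in ss awi bwj.
apply: (sum_of_translates_lt (w := w)) => //.
- exact: FM.
- move=> l; have [->|li] := eqVneq l i; first by move=> _; apply/eqP; lra.
  have [->|lj] := eqVneq l j; first by move=> _; apply/eqP; lra.
  by rewrite xl// eqxx.
rewrite (bigD1 i)//= [ltRHS](bigD1 i)//=.
rewrite (bigD1 j) ?(eq_sym j)//= [\sum_(_ | _ != i) _ in ltRHS](bigD1 j) ?(eq_sym j)//=.
rewrite (eq_bigr (fun l => r ord0 l * fine (kext K (s - w ord0 l)))); last first.
  by move=> l /andP[li lj]; rewrite xl.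
rewrite !addrA ltrD2r xi xj.
have bal : r ord0 j * (s - w ord0 j - (s - (w ord0 j + b))) =
           r ord0 i * (s - (w ord0 i - a) - (s - w ord0 i)).
  rewrite /a /b; field; by rewrite !gt_eqF.
have spread A : strictly_concave_on A K -> A (s - (w ord0 j + b)) ->
    A (s - (w ord0 i - a)) ->
    r ord0 j * K (s - (w ord0 j + b)) + r ord0 i * K (s - (w ord0 i - a)) <
    r ord0 j * K (s - w ord0 j) + r ord0 i * K (s - w ord0 i).
  by move=> cA A1 A4; apply: (concave_spread cA) => //; lra.
clear M0 FM small.
have kE x : x != 0 -> x != -1 -> x != 1 -> fine (kext K x) = K x.
  by move=> x0 xN1 x1; rewrite kextE.
have spreadE : r ord0 j * K (s - (w ord0 j + b)) + r ord0 i * K (s - (w ord0 i - a)) <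
    r ord0 j * K (s - w ord0 j) + r ord0 i * K (s - w ord0 i).
  case: ss => ss.
    by apply: (spread _ hKconc.1); rewrite /= in_itv/=; lra.
  by apply: (spread _ hKconc.2); rewrite /= in_itv/=; lra.
by case: ss => ss; rewrite !kE; lra.
Unshelve. all: end_near. Qed.

(** Spread the ends of the interval with the small local maximum.  An end at 0
    or 1 cannot move, but then no point of [0, 1] lies beyond it. *)
Lemma overall_max_improvable (w : 'rV[R]_n) (k : 'I_n.+1) : closed_simplex w ->
  (interval_max K J r w k < mbar w)%E ->
  exists2 y, closed_simplex y & (mbar y < mbar w)%E.
Proof.
move=> cw klt; set M := mbar w in klt *.
have M0 : (-oo < M)%E by apply: le_lt_trans klt; exact: leNye.
have FM s : 0 <= s <= 1 -> (F w s <= M)%E by exact: sum_of_translates_le_max.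
have inside t : node w k <= t <= node w k.+1 -> (F w t < M)%E.
  move=> tk; apply: le_lt_trans klt; apply: ereal_sup_ubound.
  by exists t => //; rewrite /= in_itv.
have kn : (k <= n)%N by rewrite -ltnS.
have outside t : node w k <= t <= node w k.+1 \/ (t < node w k \/ node w k.+1 < t).
  have [|tk] := ltP t (node w k); first by right; left.
  have [|kt] := ltP (node w k.+1) t; first by right; right.
  by left.
have [w0|w0] := ltP 0 (node w k); have [w1|w1] := ltP (node w k.+1) 1.
- have [i [ik ie ilt]] := cluster_first cw kn w0.
  have [j [kj je jlt]] := cluster_last cw kn w1.
  have ij : i != j by apply/negP => /eqP ij; move: ik; rewrite ij ltnNge kj.
  have [ri rj] := (hr i, hr j).
  have nodes := cw k kn.
  rewrite -ie -je !nodeS in w0 w1 nodes.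
  apply: (improvement (w := w) (d := spread_direction i j)) => //.
  + move=> l; rewrite spread_directionE; have [->//|_] := eqVneq l j.
    by rewrite mulr0 sub0r oppr_gt0 ltNge mulr_ge0// ?invr_ge0 ltW.
  + move=> l; rewrite spread_directionE; have [->//|_] := eqVneq l i.
    by rewrite mulr0 subr0 ltNge mulr_ge0// ?invr_ge0 ltW.
  + move=> t t01; have [/inside|out] := outside t; [by left|right].
    rewrite -ie -je !nodeS in out.
    exact: spread_lower.
- have [i [ik ie ilt]] := cluster_first cw kn w0.
  apply: (improvement (w := w) (d := - delta_mx ord0 i)) => //.
  + by move=> l; rewrite !mxE eqxx oppr_gt0 ltNge ler0n.
  + move=> l; rewrite !mxE eqxx; have [->//|_] := eqVneq l i.
    by rewrite oppr0 ltxx.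
  + move=> t t01; have [/inside|[out|out]] := outside t; [by left|right|].
      by apply: shift_left_lower => //; rewrite -nodeS ie.
    by case/andP: t01 => _; rewrite leNgt (le_lt_trans w1 out).
- have [j [kj je jlt]] := cluster_last cw kn w1.
  apply: (improvement (w := w) (d := delta_mx ord0 j)) => //.
  + move=> l; rewrite !mxE eqxx; have [->//|_] := eqVneq l j.
    by rewrite ltxx.
  + by move=> l; rewrite !mxE eqxx ltNge ler0n.
  + move=> t t01; have [/inside|[out|out]] := outside t; [by left| |right].
      by case/andP: t01; rewrite leNgt (lt_le_trans out w0).
    by apply: shift_right_lower => //; rewrite -nodeS je.
- exists w => //; apply: overall_max_lt => // t t01; apply: inside; lra.
Qed.
End sum_of_translates.

Theorem theorem3p1 (R : realType) (n : nat) (K : R -> R) (J : R -> \bar R)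
    (r : 'rV[R]_n)
    (hK : kernel_function K) (hKsing : singular K)
    (hKconc : strictly_concave K) (hKmono : strictly_monotone K)
    (hJ : field_function n J) (hJusc : upper_semicontinuous_on `[0, 1] J)
    (hr : forall j : 'I_n, 0 < r ord0 j) :
  (exists w : 'rV[R]_n, minimum_point K J r w) /\
  (forall w : 'rV[R]_n, minimum_point K J r w ->
     equioscillation_point K J r w /\ regularity_set K J r w).
Proof.
split; first exact: minimum_point_exists.
move=> w [cw wmin].
have eqM k : interval_max K J r w k = overall_max K J r w.
  apply/eqP; rewrite eq_le le_bigmax/= leNgt; apply/negP => klt.
  have [y cy] := overall_max_improvable hK hKsing hKconc hKmono hJ hJusc hr cw klt.
  by rewrite ltNge wmin ereal_inf_lbound//; exists y.
have finM : (-oo < overall_max K J r w)%E by exact: overall_max_gtNy.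
split; first by move=> i j; rewrite !eqM.
split; last by move=> k; rewrite eqM -ltNye.
move=> k kn; rewrite lt_neqAle cw// andbT; apply/negP => /eqP kk.
have /= deg := interval_max_degenerate (K := K) J hKsing hr
  (k := Ordinal (kn : (k < n.+1)%N)) kk.
by move: finM; rewrite -(eqM (Ordinal (kn : (k < n.+1)%N))) deg ltxx.
Qed.
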